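(* Let $\mathcal{X}$ be a 3-order real tensor of size $I_1\times I_2\times I_3$ and let $A_k\in\mathbb{R}^{I_k\times R}$, $k=1,2,3$, be matrices such that $\mathcal{X}=[[A_1,A_2,A_3]]$. Then for every non-identity permutation $\sigma\in S_3$, $$\mathcal{X}^{T\sigma}=[[A_{\sigma(1)},A_{\sigma(2)},A_{\sigma(3)}]].$$
   Context: Tensor transpose: for a non-identity permutation $\sigma\in S_N$ and an $N$-order tensor $\mathcal{X}$ of size $I_1\times\cdots\times I_N$, the transpose $\mathcal{X}^{T\sigma}$ is the tensor of size $I_{\sigma(1)}\times\cdots\times I_{\sigma(N)}$ with entries $\mathcal{X}^{T\sigma}(i_{\sigma(1)},\dots,i_{\sigma(N)})=\mathcal{X}(i_1,\dots,i_N)$ for all indices. Outer product: for vectors $u_1,u_2,u_3$, $u_1\circ u_2\circ u_3$ is the 3-order tensor with entries $u_1(i_1)u_2(i_2)u_3(i_3)$. CP decomposition notation: if $A_1=(a_1\ \cdots\ a_R)$, $A_2=(b_1\ \cdots\ b_R)$, $A_3=(c_1\ \cdots\ c_R)$ are matrices given by their columns, then $[[A_1,A_2,A_3]]:=\sum_{i=1}^R a_i\circ b_i\circ c_i$. *)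

(* Defs.v *)
From mathcomp Require Import all_boot all_order all_fingroup all_algebra.
From mathcomp Require Import reals.

Set Implicit Arguments.
Unset Strict Implicit.
Unset Printing Implicit Defensive.

Import GRing.Theory.
Local Open Scope ring_scope.

(* Modes are numbered from 0: the mode k of the usual 1-based notation is the
   element k-1 of 'I_N. *)
Definition tindex (N : nat) (I : 'I_N -> nat) : Type :=
  {dffun forall k : 'I_N, 'I_(I k)}.

Definition tensor (K : Type) (N : nat) (I : 'I_N -> nat) : Type :=
  {ffun tindex I -> K}.

(* (i_1, ..., i_N) |-> (i_{s(1)}, ..., i_{s(N)}) *)
Definition tindex_perm (N : nat) (I : 'I_N -> nat) (s : 'S_N)
    (i : tindex I) : tindex (fun k => I (s k)) :=
  [ffun k => i (s k)].

(* The inverse of tindex_perm; the cast goes along s (s^-1 k) = k. *)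
Definition tindex_unperm (N : nat) (I : 'I_N -> nat) (s : 'S_N)
    (j : tindex (fun k => I (s k))) : tindex I :=
  [ffun k => cast_ord (congr1 I (permKV s k)) (j (s^-1%g k))].

Definition ttranspose (K : Type) (N : nat) (I : 'I_N -> nat) (s : 'S_N)
    (X : tensor K I) : tensor K (fun k => I (s k)) :=
  [ffun j => X (@tindex_unperm N I s j)].

Lemma tindex_permK (N : nat) (I : 'I_N -> nat) (s : 'S_N) :
  cancel (@tindex_perm N I s) (@tindex_unperm N I s).
Proof.
move=> i; apply/ffunP => k; rewrite !ffunE.
have cast_i a b (e : a = b) : cast_ord (congr1 I e) (i a) = i b.
  by case: _ / e; apply: val_inj.
exact: cast_i.
Qed.

Lemma tindex_unpermK (N : nat) (I : 'I_N -> nat) (s : 'S_N) :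
  cancel (@tindex_unperm N I s) (@tindex_perm N I s).
Proof.
move=> j; apply/ffunP => k; rewrite !ffunE; apply: val_inj => /=.
have val_j a b : a = b -> val (j a) = val (j b) by move=> ->.
by apply: val_j; rewrite permK.
Qed.

(* X^{Ts}(i_{s(1)}, ..., i_{s(N)}) = X(i_1, ..., i_N); by tindex_unpermK this
   determines all the entries of X^{Ts}. *)
Lemma ttransposeE (K : Type) (N : nat) (I : 'I_N -> nat) (s : 'S_N)
    (X : tensor K I) (i : tindex I) :
  ttranspose s X (tindex_perm s i) = X i.
Proof. by rewrite ffunE tindex_permK. Qed.

Definition mode1 : 'I_3 := @Ordinal 3 0 isT.
Definition mode2 : 'I_3 := @Ordinal 3 1 isT.
Definition mode3 : 'I_3 := @Ordinal 3 2 isT.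

Definition outer3 (K : pzRingType) (I : 'I_3 -> nat) (u1 : 'cV[K]_(I mode1))
    (u2 : 'cV[K]_(I mode2)) (u3 : 'cV[K]_(I mode3)) : tensor K I :=
  [ffun i : tindex I => u1 (i mode1) 0 * u2 (i mode2) 0 * u3 (i mode3) 0].

Definition cp3 (K : pzRingType) (I : 'I_3 -> nat) (r : nat)
    (A1 : 'M[K]_(I mode1, r)) (A2 : 'M[K]_(I mode2, r))
    (A3 : 'M[K]_(I mode3, r)) : tensor K I :=
  \sum_(l < r) outer3 (col l A1) (col l A2) (col l A3).

(* Main.v *)
Require Import Defs.
From mathcomp Require Import all_boot all_order all_fingroup all_algebra.
From mathcomp Require Import reals.

(* Over a commutative ring the entry of a CP tensor is a symmetric expression
   in the modes, a sum of products over all k : 'I_3, so transposing by s only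
   reindexes these products along s. *)

(** [cp3E] supplies this symmetric form for any family [A], so in [ttranspose_cp3] it applies to
    both sides: to [A], and to the family [A (s k)]. *)

Lemma cp3E (K : comPzRingType) (I : 'I_3 -> nat) (r : nat)
    (A : forall k : 'I_3, 'M[K]_(I k, r)) (i : tindex I) :
  cp3 (A mode1) (A mode2) (A mode3) i =
    (\sum_(l < r) \prod_(k < 3) A k (i k) l)%R.
Proof.
rewrite /cp3 sum_ffunE; apply: eq_bigr => l _.
rewrite ffunE !mxE !big_ord_recl big_ord0 GRing.mulr1 GRing.mulrA.
(* The type of [A a] depends on [a], so the ordinals left by [big_ord_recl] are exchanged for the
   modes in a whole entry, which lies in [K]. *)
have eqA a b : a = b -> A a (i a) l = A b (i b) l by move=> ->.
by congr (_ * _ * _)%R; apply: eqA; apply: val_inj.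
Qed.

Lemma ttranspose_cp3 (K : comPzRingType) (I : 'I_3 -> nat) (r : nat)
    (A : forall k : 'I_3, 'M[K]_(I k, r)) (s : 'S_3) :
  ttranspose s (cp3 (A mode1) (A mode2) (A mode3)) =
    @cp3 K (fun k => I (s k)) r (A (s mode1)) (A (s mode2)) (A (s mode3)).
Proof.
(* Every multi-index is a permuted one, so the entry is read off without casts. *)
apply/ffunP => j; rewrite -[j]tindex_unpermK ttransposeE.
move: (tindex_unperm j) => {j} i.
rewrite cp3E (@cp3E K (fun k => I (s k)) r (fun k => A (s k))).
apply: eq_bigr => l _; rewrite (reindex_inj (@perm_inj _ s)) /=.
by apply: eq_bigr => k _; rewrite ffunE.
Qed.

Theorem proposition5p2 (R : realType) (I : 'I_3 -> nat) (r : nat)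
    (X : tensor R I) (A : forall k : 'I_3, 'M[R]_(I k, r))
    (hX : X = cp3 (A mode1) (A mode2) (A mode3))
    (s : 'S_3) (hs : s <> 1%g) :
  ttranspose s X =
    @cp3 R (fun k => I (s k)) r (A (s mode1)) (A (s mode2)) (A (s mode3)).
Proof. by rewrite hX ttranspose_cp3. Qed.
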